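(* Let $\Phi_1,\ldots,\Phi_n$ be positive linear maps on $\mathbb{B}(\mathscr{H})$ with $\sum_{i=1}^{n}\Phi_i(I)=I$ and let $B_1,\ldots,B_n\in\sigma([m,M])$ for two scalars $m<M$. If $f$ is a continuous convex function on $[m,M]$, then $$\begin{aligned} f\left(m+M-\sum_{i=1}^{n}\Phi_i(B_i)\right)&\leq f(m)+f(M)-\sum_{i=1}^{n}\Phi_i(f(B_i))-\delta_f\widetilde{B}\\&\leq f(m)+f(M)-\sum_{i=1}^{n}\Phi_i(f(B_i)),\end{aligned}$$ where $\delta_f=f(m)+f(M)-2f\left(\frac{m+M}{2}\right)$ and $$\widetilde{B}=1-\frac{1}{M-m}\left[\sum_{i=1}^{n}\Phi_i\left(\left|B_i-\frac{m+M}{2}\right|\right)+\left|\sum_{i=1}^{n}\Phi_i(B_i)-\frac{m+M}{2}\right|\right].$$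
   Context: $\mathscr{H}$ is a complex Hilbert space, $\mathbb{B}(\mathscr{H})$ the $C^*$-algebra of bounded linear operators on it, $I$ the identity. $\sigma(J)$ denotes the set of all self-adjoint operators on $\mathscr{H}$ with spectra contained in $J$. The order $\leq$ on self-adjoint operators is the usual one ($S\leq T$ iff $T-S$ is positive semidefinite); a scalar in an operator inequality or expression stands for that scalar times $I$. $f(T)$ is defined by continuous functional calculus and $|T|=(T^2)^{1/2}$. A linear map on $\mathbb{B}(\mathscr{H})$ is positive if it maps positive operators to positive operators. All real-valued functions are assumed continuous throughout the paper. *)

(* Defs.v *)
From HB Require Import structures.
From mathcomp Require Import all_boot all_order all_algebra.
From mathcomp Require Import complex.
From mathcomp Require Import all_classical all_reals all_analysis.

Set Implicit Arguments.
Unset Strict Implicit.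
Unset Printing Implicit Defensive.

Import Order.TTheory GRing.Theory Num.Theory numFieldNormedType.Exports.

Local Open Scope classical_set_scope.
Local Open Scope complex_scope.
Local Open Scope ring_scope.

(* Completeness of the space and the topology come from completeNormedModType;
   the inner product is linear in its first argument and induces the norm.
   The zero space is allowed. *)
HB.mixin Record CompleteNormedModule_isHilbert (R : realType) H
    of CompleteNormedModule R[i] H := {
  inner : {dot H for @Num.conj R[i]};
  normr_inner : forall x : H, `|x| ^+ 2 = inner x x
}.

#[short(type="hilbertType")]
HB.structure Definition Hilbert (R : realType) :=
  {H of CompleteNormedModule R[i] H & CompleteNormedModule_isHilbert R H}.

Section BoundedOperators.
Context {R : realType} (H : hilbertType R).

(* For linear maps, bounded and continuous are the same: see
   linear_bounded_continuous. *)
Definition bounded_op : {pred H -> H} :=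
  fun f => `[< linear f /\ continuous f >].

Lemma bounded_opP (f : H -> H) :
  reflect (linear f /\ continuous f) (f \in bounded_op).
Proof. exact: asboolP. Qed.

Fact bounded_op_submod : subsemimod_closed bounded_op.
Proof.
split; first split.
- apply/bounded_opP; split=> [a x y|]; first by rewrite scaler0 addr0.
  exact: cst_continuous.
- move=> f g /bounded_opP[lf cf] /bounded_opP[lg cg]; apply/bounded_opP.
  split=> [a x y|x]; last exact: (@continuousD _ H H f g x (cf x) (cg x)).
  by rewrite !fctE lf lg scalerDr addrACA.
- move=> a f /bounded_opP[lf cf]; apply/bounded_opP; split=> [b x y|x].
    by rewrite !fctE lf scalerDr !scalerA mulrC.
  by apply: cvgZl_tmp; exact: cf.
Qed.

HB.instance Definition _ :=
  GRing.isSubmodClosed.Build R[i] (H -> H) bounded_op bounded_op_submod.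

Record bop : Type := Bop { bop_fun :> H -> H; _ : bop_fun \in bounded_op }.

HB.instance Definition _ := [isSub for bop_fun].
HB.instance Definition _ := [Choice of bop by <:].
HB.instance Definition _ := [SubChoice_isSubLmodule of bop by <:].

Lemma bop_linear (T : bop) : linear T.
Proof. by case: T => f /= /bounded_opP[]. Qed.

Lemma bop_continuous (T : bop) : continuous T.
Proof. by case: T => f /= /bounded_opP[]. Qed.

HB.instance Definition _ (T : bop) :=
  GRing.isLinear.Build R[i] H H *:%R (bop_fun T) (bop_linear T).

Fact bop_one_subproof : (id : H -> H) \in bounded_op.
Proof. by apply/bounded_opP; split=> // x; exact: cvg_id. Qed.

Definition bop_one : bop := Bop bop_one_subproof.

Fact bop_comp_subproof (S T : bop) : (S \o T : H -> H) \in bounded_op.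
Proof.
apply/bounded_opP; split=> [a x y|x]; first by rewrite /= !linearP.
by apply: continuous_comp; exact: bop_continuous.
Qed.

Definition bop_comp (S T : bop) : bop := Bop (bop_comp_subproof S T).

Lemma bopP (S T : bop) : S =1 T -> S = T.
Proof. by move=> ST; apply/val_inj/funext. Qed.

Fact bop_compA : associative bop_comp.
Proof. by move=> S T U; exact: bopP. Qed.
Fact bop_comp1l : left_id bop_one bop_comp.
Proof. by move=> T; exact: bopP. Qed.
Fact bop_comp1r : right_id bop_one bop_comp.
Proof. by move=> T; exact: bopP. Qed.
Fact bop_compDl : left_distributive bop_comp +%R.
Proof. by move=> S T U; exact: bopP. Qed.
Fact bop_compDr : right_distributive bop_comp +%R.
Proof. by move=> S T U; apply: bopP => x /=; rewrite linearD. Qed.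

(* Only a possibly zero ring, since H may be the zero space. *)
HB.instance Definition _ := GRing.Zmodule_isPzRing.Build bop
  bop_compA bop_comp1l bop_comp1r bop_compDl bop_compDr.

End BoundedOperators.

Notation "{ 'bop' H }" := (bop H) (format "{ 'bop'  H }") : type_scope.

Section FunctionalCalculus.
Context {R : realType} {H : hilbertType R}.
Implicit Types (S T : {bop H}) (f : R -> R) (p : {poly R}).

Definition scalar_op (z : R[i]) : {bop H} := z *: (1 : {bop H}).

Definition opnorm T : R :=
  sup [set complex.Re `|T x| | x in [set x : H | `|x| <= 1]].

Definition selfadjoint T := forall x y : H, inner (T x) y = inner x (T y).

(* 0 <= z in R[i] means that z is real and nonnegative. *)
Definition positive_op T := selfadjoint T /\ forall x : H, 0 <= inner (T x) x.

Definition le_op S T := positive_op (T - S).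

Definition spectrum T : set R[i] :=
  [set z | ~ exists S, (T - scalar_op z) * S = 1 /\ S * (T - scalar_op z) = 1].

Definition sa_spec (J : set R) : set {bop H} :=
  [set T | selfadjoint T /\ spectrum T `<=` [set t%:C | t in J]].

Definition poly_op p T : {bop H} := \sum_(i < size p) (p`_i)%:C *: T ^+ i.

(* f(T) for self-adjoint T and f continuous on the spectrum of T: the limit in
   operator norm of p_k(T) for any real polynomials p_k converging to f
   uniformly on the spectrum. *)
Definition is_cfc f T S :=
  forall p : nat -> {poly R},
    {uniform [set t : R | spectrum T t%:C],
      (fun k (t : R) => (p k).[t]) @ \oo --> f} ->
    opnorm (poly_op (p k) T - S) @[k --> \oo] --> 0.

(* The default value 0 is relevant only when no operator satisfies is_cfc. *)
Definition cfc f T : {bop H} := xget 0 [set S | is_cfc f T S].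

Definition abs_op T : {bop H} := cfc Num.sqrt (T ^+ 2).

Definition positive_map (Phi : {bop H} -> {bop H}) :=
  forall T, positive_op T -> positive_op (Phi T).

End FunctionalCalculus.

(* Main.v *)
From HB Require Import structures.
Require Import Defs.
From mathcomp Require Import all_boot all_order all_algebra.
From mathcomp Require Import complex.
From mathcomp Require Import all_classical all_reals all_analysis.
From mathcomp Require Import ring lra.

Set Implicit Arguments.
Unset Strict Implicit.
Unset Printing Implicit Defensive.

Import Order.TTheory GRing.Theory Num.Theory numFieldNormedType.Exports.

Local Open Scope classical_set_scope.
Local Open Scope complex_scope.
Local Open Scope ring_scope.

(** An inequality between continuous functions on [m, M] passes to the self-adjoint
operators with spectrum in [m, M], in particular to the B_i and to
C = m + M - sum_i Phi_i(B_i).  The inequality needed is a scalar one: with mid = (m + M) / 2 and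
delta = f(m) + f(M) - 2 f(mid), a convex f satisfies on [m, M]

  f(t) <= chord(t) - delta * (1/2 - |t - mid| / (M - m)),

because f is convex on each half of [m, M] separately, and the right-hand side
interpolates f linearly between m, mid and M ([convex_tent]).  Apply this at
each B_i, map by Phi_i and sum; apply it also at C.  The chord is affine and
sum_i Phi_i(I) = I, so the chord terms of the two inequalities add up to
f(m) + f(M); moreover |C - mid| = |sum_i Phi_i(B_i) - mid|, so the remaining
terms add up to -delta times the operator B-tilde.  This is the first
inequality.  The second one holds as delta >= 0 and
|T - mid| <= (M - m) / 2 for T with spectrum in [m, M].

The rest of the development makes the functional calculus available.

- A self-adjoint A has the infimum of its numerical range in its spectrum
  ([spectrum_inf]): if A - a >= 0 is invertible then it is bounded below by a
  positive constant.  Combined with the spectral mapping theorem, obtained by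
  factoring p - z over the complex numbers ([spectrum_cpoly]), this shows that
  p(T) >= 0 as soon as p >= 0 on the spectrum of T ([poly_op_positive]), whence
  the bound of p(T) by the supremum of |p| on the spectrum ([poly_op_bound]).
- By this bound, polynomials converging uniformly to f on [m, M] give a Cauchy
  sequence of operators, so that f(T) exists ([cfc_is_cfc]).  Such polynomials
  exist by Bernstein's proof of the Weierstrass theorem ([weierstrass]).
- The relation [fcalc m M T g S], saying that S is g(T), is compatible with
  linear combinations and positivity.  It contains the absolute value
  |T - c|, although that one is defined as a square root of (T - c)^2
  ([fcalc_abs]).
- Positive unital families preserve the bounds m <= B_i <= M, and an operator
  between m and M has its spectrum in [m, M] ([spectrum_segment]); inverses come
  from the Neumann series ([neumann]). *)

(** * Polynomial approximation and convex functions *)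

Section RealApproximation.
Context {R : realType}.
Implicit Types (f : R -> R) (a b x e : R).

(** Heine-Cantor: a radius that works at x, halved, works at all points near x,
and finitely many such x suffice by compactness. *)
Lemma segment_unif_continuous f a b : {within `[a, b], continuous f} ->
  forall e, 0 < e -> exists2 d, 0 < d &
    forall x y, x \in `[a, b] -> y \in `[a, b] -> `|x - y| < d ->
      `|f x - f y| < e.
Proof.
move=> /subspace_continuousP fc e e0.
have /compact_near_coveringP/near_covering_withinP cab := @segment_compact R a b.
pose P (d x : R) := forall y, y \in `[a, b] -> `|x - y| < d -> `|f x - f y| < e.
have H : \forall d \near (0 : R)^'+, `[a, b]%classic `<=` P d.
  apply: cab => x xab; have e2 : 0 < e / 2 by rewrite divr_gt0.
  have /cvgrPdist_lt/(_ _ e2) := fc x xab.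
  rewrite /prop_near1 /within /= => /nbhs_ballP[r /= r0 fr].
  exists (ball x (r / 2), [set d | d < r / 2]) => /=.
    split; first by apply: nbhsx_ballx; rewrite divr_gt0.
    by apply: nbhs_right_lt; rewrite divr_gt0.
  move=> [z d] [/=]; rewrite /ball /= => xz dr zab y yab zy.
  have xy : `|x - y| < r.
    by rewrite (splitr r) (le_lt_trans (ler_distD z _ _))// ltrD// (lt_trans zy).
  have xz' : `|x - z| < r by rewrite (lt_trans xz)// ltr_pdivrMr// ltr_pMr// ltrDl.
  rewrite (splitr e) (le_lt_trans (ler_distD (f x) _ _))// ltrD//.
    by rewrite distrC; apply: fr => //; rewrite itv_boundlr in zab.
  exact: fr.
have [d [d0 Hd]] : exists d, 0 < d /\ `[a, b]%classic `<=` P d.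
  have : \forall d \near (0 : R)^'+, 0 < d /\ `[a, b]%classic `<=` P d.
    by near=> d; split => //; near: d.
  by move/filter_ex.
by exists d => // x y xab; apply: Hd.
Unshelve. all: by end_near. Qed.

(** The Bernstein polynomial: its value at x is the expectation of g(K) for K
binomial with parameters n and x.  The recursion conditions on the first trial;
it replaces all computations with binomial coefficients by inductions on n. *)
Fixpoint bernstein (n : nat) (g : nat -> R) : {poly R} :=
  if n is n'.+1 then
    (1 - 'X) * bernstein n' g + 'X * bernstein n' (fun k => g k.+1)
  else (g 0%N)%:P.

Lemma bernsteinS n g x : (bernstein n.+1 g).[x] =
  (1 - x) * (bernstein n g).[x] + x * (bernstein n (fun k => g k.+1)).[x].
Proof. by rewrite /= !hornerE. Qed.

Lemma bernstein_cst n c x : (bernstein n (fun=> c)).[x] = c.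
Proof.
by elim: n => [|n IH]; rewrite ?bernsteinS/= ?hornerE// IH; ring.
Qed.

Lemma bernsteinD n g h x : (bernstein n (fun k => g k + h k)).[x] =
  (bernstein n g).[x] + (bernstein n h).[x].
Proof.
elim: n g h => [|n IH] g h; first by rewrite /= !hornerE.
by rewrite !bernsteinS !IH; ring.
Qed.

Lemma bernsteinZ n c g x : (bernstein n (fun k => c * g k)).[x] =
  c * (bernstein n g).[x].
Proof.
elim: n g => [|n IH] g; first by rewrite /= !hornerE.
by rewrite !bernsteinS !IH; ring.
Qed.

Lemma bernstein_le n g h x : 0 <= x <= 1 ->
  (forall k, (k <= n)%N -> g k <= h k) ->
  (bernstein n g).[x] <= (bernstein n h).[x].
Proof.
move=> /andP[x0 x1]; elim: n g h => [|n IH] g h gh.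
  by rewrite /= !hornerE gh.
rewrite !bernsteinS; apply: lerD; apply: ler_wpM2l; rewrite ?subr_ge0//;
  apply: IH => k kn.
  exact/gh/(leq_trans kn).
exact: gh.
Qed.

(** Mean and variance of the binomial law in one formula.  The centre c is
arbitrary because conditioning on the first trial moves it to c - 1. *)
Lemma bernstein_sqr n c x :
  (bernstein n (fun k => (k%:R - c) ^+ 2)).[x] =
  n%:R * x * (1 - x) + (n%:R * x - c) ^+ 2.
Proof.
elim: n c => [|n IH] c; first by rewrite /= !hornerE; ring.
have -> : (bernstein n.+1 (fun k => (k%:R - c) ^+ 2)).[x] =
  (1 - x) * (bernstein n (fun k => (k%:R - c) ^+ 2)).[x] +
  x * (bernstein n (fun k => (k%:R - (c - 1)) ^+ 2)).[x].
  rewrite bernsteinS; congr (_ + _ * (bernstein _ _).[_]).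
  by apply/funext => k; rewrite -natr1; ring.
by rewrite !IH -natr1; ring.
Qed.

(** Chebyshev's argument: under the binomial law k/n is within d of x up to a
probability of order 1/n, uniformly in x. *)
Lemma weierstrass_unit f : {within `[0, 1], continuous f} ->
  forall e, 0 < e -> exists p : {poly R},
    forall x, x \in `[0, 1] -> `|p.[x] - f x| <= e.
Proof.
move=> fc e e0.
have e2 : 0 < e / 2 by rewrite divr_gt0.
have [d d0 fd] := segment_unif_continuous fc e2.
have [c1 _ fmax] := EVT_max (@ler01 R) fc.
have [c2 _ fmin] := EVT_min (@ler01 R) fc.
pose D := f c1 - f c2.
have fD x y : x \in `[0, 1] -> y \in `[0, 1] -> `|f x - f y| <= D.
  move=> x01 y01; have := fmax _ x01; have := fmin _ x01.
  have := fmax _ y01; have := fmin _ y01.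
  by rewrite /D ler_norml => *; apply/andP; split; lra.
have D0 : 0 <= D.
  by apply: le_trans (fD 0 0 _ _); rewrite // in_itv/= lexx ler01.
pose C := D / d ^+ 2.
have C0 : 0 <= C by rewrite divr_ge0// ltW// exprn_gt0.
(* Far from x the variation of f is dominated by a multiple of the squared
   distance, whose expectation is the variance. *)
have fC x y : x \in `[0, 1] -> y \in `[0, 1] ->
    `|f y - f x| <= e / 2 + C * (y - x) ^+ 2.
  move=> x01 y01; have [yx|yx] := ltP `|y - x| d.
    by rewrite (le_trans (ltW (fd _ _ _ _ yx)))// lerDl mulr_ge0// sqr_ge0.
  rewrite (le_trans (fD _ _ _ _))// ler_wpDl ?(ltW e2)//.
  rewrite /C -mulrA ler_peMr// mulrC ler_pdivlMr ?exprn_gt0// mul1r.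
  by rewrite -[leRHS]real_normK ?num_real// ler_sqr ?nnegrE// ltW.
(* n makes C / n at most e / 2, and C / n bounds the variance term. *)
pose n := (Num.truncn (2 * C / e)).+1.
have n0 : 0 < n%:R :> R by rewrite ltr0n.
have Cn : C / n%:R <= e / 2.
  have : 2 * C / e < n%:R by exact: truncnS_gt.
  rewrite ltr_pdivrMr// ler_pdivrMr// => ?; lra.
exists (bernstein n (fun k => f (k%:R / n%:R))) => x x01.
have /andP[x0 x1] : 0 <= x <= 1 by rewrite in_itv in x01.
have -> : (bernstein n (fun k => f (k%:R / n%:R))).[x] - f x =
    (bernstein n (fun k => f (k%:R / n%:R) + - f x)).[x].
  by rewrite bernsteinD bernstein_cst.
pose h (k : nat) := e / 2 + C / n%:R ^+ 2 * (k%:R - n%:R * x) ^+ 2.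
have fh k : (k <= n)%N -> `|f (k%:R / n%:R) - f x| <= h k.
  move=> kn; have kn01 : (k%:R / n%:R : R) \in `[0, 1].
    by rewrite in_itv/= divr_ge0//= ler_pdivrMr// mul1r ler_nat.
  rewrite (le_trans (fC _ _ x01 kn01))// lerD2l /h -mulrA ler_wpM2l//.
  rewrite le_eqVlt; apply/orP; left; apply/eqP; field; exact: lt0r_neq0.
have hE : (bernstein n h).[x] <= e.
  rewrite /h bernsteinD bernstein_cst bernsteinZ bernstein_sqr subrr expr0n.
  rewrite /= addr0 [leRHS](splitr e) lerD2l (le_trans _ Cn)//.
  have -> : C / n%:R ^+ 2 * (n%:R * x * (1 - x)) = C / n%:R * (x * (1 - x)).
    by field; exact: lt0r_neq0.
  rewrite ler_piMr ?divr_ge0//; nra.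
have hN : - (bernstein n h).[x] = (bernstein n (fun k => - h k)).[x].
  rewrite -mulN1r -bernsteinZ; congr (horner (bernstein _ _) _).
  by apply/funext => k; rewrite mulN1r.
rewrite (le_trans _ hE)// ler_norml hN.
by rewrite !bernstein_le ?x0 ?x1// => k /fh; rewrite ler_norml => /andP[].
Qed.

Theorem weierstrass f a b : a < b -> {within `[a, b], continuous f} ->
  forall e, 0 < e -> exists p : {poly R},
    forall x, x \in `[a, b] -> `|p.[x] - f x| <= e.
Proof.
move=> ab fc e e0; have ba0 : 0 < b - a by rewrite subr_gt0.
pose g s := f (a + s * (b - a)).
have gc : {within `[0, 1], continuous g}.
  apply/subspace_continuousP => s s01.
  apply/cvgrPdist_lt => eps eps0.
  have [d d0 fd] := segment_unif_continuous fc eps0.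
  have ab_in t : t \in `[0, 1] -> a + t * (b - a) \in `[a, b].
    rewrite !in_itv/= => /andP[t0 t1].
    have := mulr_ge0 t0 (ltW ba0).
    have : t * (b - a) <= b - a by rewrite ler_piMl// ltW.
    by move=> *; apply/andP; split; lra.
  apply/nbhs_ballP; exists (d / (b - a)); first by rewrite /= divr_gt0.
  move=> t; rewrite /ball /= => st t01; apply: fd; [exact: ab_in|exact: ab_in|].
  rewrite opprD addrACA subrr add0r -mulrBl normrM (gtr0_norm ba0).
  by rewrite -ltr_pdivlMr.
have [p pg] := weierstrass_unit gc e0.
exists (p \Po ((b - a)^-1 *: ('X - a%:P))) => x; rewrite in_itv/= => /andP[ax xb].
rewrite horner_comp !hornerE.
have -> : f x = g ((b - a)^-1 * (x - a)).
  by rewrite /g; congr f; field; exact: lt0r_neq0.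
apply: pg; rewrite in_itv/= mulrC divr_ge0 ?subr_ge0 ?(ltW ab)//=.
by rewrite ler_pdivrMr// mul1r lerB.
Qed.

Lemma weierstrass_seq f a b : a < b -> {within `[a, b], continuous f} ->
  exists p : nat -> {poly R}, forall e, 0 < e -> exists N, forall k, (N <= k)%N ->
    forall x, x \in `[a, b] -> `|(p k).[x] - f x| <= e.
Proof.
move=> ab fc.
have k0 k : 0 < k.+1%:R^-1 :> R by rewrite invr_gt0 ltr0n.
have [p pf] := choice (fun k : nat => weierstrass ab fc (k0 k)).
exists p => e e0; exists (Num.truncn e^-1) => k Nk x xab.
rewrite (le_trans (pf k x xab))// invf_ple ?posrE ?ltr0n// ltW//.
by rewrite (lt_le_trans (truncnS_gt _))// ler_nat.
Qed.

Lemma convex_segment f m M s x y :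
  convex_function (`[m, M]%classic : set R^o) f -> 0 <= s <= 1 ->
  m <= x <= M -> m <= y <= M ->
  f (s * x + (1 - s) * y) <= s * f x + (1 - s) * f y.
Proof.
move=> fc /andP[s0 s1] xmM ymM.
by have := fc (Itv01 s0 s1) x y; rewrite !inE/= !in_itv/= => /(_ xmM ymM).
Qed.

Lemma convex_midpoint m M f : m < M ->
  convex_function (`[m, M]%classic : set R^o) f ->
  0 <= f m + f M - 2 * f ((m + M) / 2).
Proof.
move=> mM fc; have h : 0 <= (1 / 2 : R) <= 1 by apply/andP; split; lra.
have mM' := ltW mM.
have := @convex_segment f m M (1 / 2) m M fc h.
rewrite !lexx !mM' => /(_ isT isT).
have -> : 1 / 2 * m + (1 - 1 / 2) * M = (m + M) / 2 by field.
lra.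
Qed.

(** The right-hand side is the piecewise linear interpolation of f at m, mid and
M, so the bound is convexity of f on each half of the segment. *)
Lemma convex_tent f (m M t : R) : m < M ->
  convex_function (`[m, M]%classic : set R^o) f -> t \in `[m, M] ->
  f t <= ((M - t) * f m + (t - m) * f M) / (M - m)
    - (f m + f M - 2 * f ((m + M) / 2)) *
      (1 / 2 - `|t - (m + M) / 2| / (M - m)).
Proof.
move=> mM fc; rewrite in_itv/= => /andP[mt tM].
have Mm0 : 0 < M - m by rewrite subr_gt0.
have cvx s x y := @convex_segment f m M s x y fc.
pose mid := (m + M) / 2.
have mM_m : m <= m <= M by rewrite lexx ltW.
have mM_M : m <= M <= M by rewrite lexx ltW.
have mM_mid : m <= mid <= M by rewrite /mid; apply/andP; split; lra.
have [tm|tm] := leP t mid.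
  pose s := (mid - t) / (mid - m).
  have mm0 : 0 < mid - m by rewrite /mid; lra.
  have s01 : 0 <= s <= 1.
    by apply/andP; split; rewrite /s ?ler_pdivrMr ?divr_ge0 ?subr_ge0//; lra.
  have tE : s * m + (1 - s) * mid = t by rewrite /s; field; exact: lt0r_neq0.
  have := cvx s m mid s01 mM_m mM_mid; rewrite tE => /le_trans; apply.
  rewrite ler0_norm ?subr_le0// le_eqVlt; apply/orP; left; apply/eqP.
  rewrite /s /mid; field; exact: lt0r_neq0.
pose s := (t - mid) / (M - mid).
have mm0 : 0 < M - mid by rewrite /mid; lra.
have s01 : 0 <= s <= 1.
  by apply/andP; split; rewrite /s ?ler_pdivrMr ?divr_ge0 ?subr_ge0//; lra.
have tE : s * M + (1 - s) * mid = t by rewrite /s; field; exact: lt0r_neq0.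
have := cvx s M mid s01 mM_M mM_mid; rewrite tE => /le_trans; apply.
rewrite gtr0_norm ?subr_gt0// le_eqVlt; apply/orP; left; apply/eqP.
rewrite /s /mid; field; exact: lt0r_neq0.
Qed.

End RealApproximation.

(** * Inner products and operator bounds *)

Section InnerProduct.
Context {R : realType} {H : hilbertType R}.
Implicit Types (x y z : H) (A S T : {bop H}) (c : R).

Lemma innerDl x y z : inner (x + y) z = inner x z + inner y z.
Proof. exact: linearDl. Qed.

Lemma innerDr x y z : inner x (y + z) = inner x y + inner x z.
Proof. exact: linearDr. Qed.

Lemma innerNl x y : inner (- x) y = - inner x y.
Proof. exact: linearNl. Qed.

Lemma innerNr x y : inner x (- y) = - inner x y.
Proof. exact: linearNr. Qed.

Lemma innerZl a x y : inner (a *: x) y = a * inner x y.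
Proof. exact: linearZl_LR. Qed.

Lemma innerZr a x y : inner x (a *: y) = a^* * inner x y.
Proof. exact: linearZr_LR. Qed.

Lemma innerC x y : inner x y = (inner y x)^*.
Proof. by rewrite (hermitian_subproof x y) expr0 mul1r. Qed.

Lemma inner_ge0 x : 0 <= inner x x :> R[i].
Proof. by rewrite -normr_inner exprn_ge0. Qed.

Lemma bop_addE S T x : (S + T) x = S x + T x. Proof. by []. Qed.
Lemma bop_oppE T x : (- T) x = - T x. Proof. by []. Qed.
Lemma bop_subE S T x : (S - T) x = S x - T x. Proof. by []. Qed.
Lemma bop_scaleE a T x : (a *: T) x = a *: T x. Proof. by []. Qed.
Lemma bop_mulE S T x : (S * T) x = S (T x). Proof. by []. Qed.
Lemma bop_oneE x : (1 : {bop H}) x = x. Proof. by []. Qed.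
Lemma bop_zeroE x : (0 : {bop H}) x = 0. Proof. by []. Qed.
Lemma scalar_opE a x : (scalar_op a : {bop H}) x = a *: x. Proof. by []. Qed.

Lemma bop_argD T x y : T (x + y) = T x + T y. Proof. exact: linearD. Qed.
Lemma bop_argZ T a x : T (a *: x) = a *: T x. Proof. exact: linearZ_LR. Qed.

Definition bopE := (bop_addE, bop_oppE, bop_scaleE, bop_mulE, bop_oneE,
  bop_zeroE, scalar_opE).

(** Identities between operators reduce to identities between complex numbers,
which can be decided by computation. *)
Lemma bop_innerP S T : (forall x y, inner (S x) y = inner (T x) y) -> S = T.
Proof.
move=> ST; apply: bopP => x; apply/eqP; rewrite -subr_eq0 -normr_eq0 -sqrf_eq0.
by rewrite normr_inner innerDl innerNl ST subrr.
Qed.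

Lemma inner_quadratic A s t x y : selfadjoint A ->
  inner (A (s *: x + t *: y)) (s *: x + t *: y) =
  s * s^* * inner (A x) x + s * t^* * inner (A x) y +
  t * s^* * (inner (A x) y)^* + t * t^* * inner (A y) y.
Proof.
move=> sA; have -> : (inner (A x) y)^* = inner (A y) x.
  by rewrite sA -innerC.
rewrite bop_argD !bop_argZ innerDl !innerDr !innerZl !innerZr; ring.
Qed.

(** Cauchy-Schwarz for the semidefinite form (x, y) |-> <A x, y>. *)
Lemma positive_op_CS A x y : positive_op A ->
  `|inner (A x) y| ^+ 2 <= inner (A x) x * inner (A y) y.
Proof.
move=> [sA pA].
set a := inner (A x) x; set b := inner (A x) y; set c := inner (A y) y.
have a0 : 0 <= a := pA x.
have c0 : 0 <= c := pA y.
have aJ : a^* = a by apply/CrealP; exact: ger0_real.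
have cJ : c^* = c by apply/CrealP; exact: ger0_real.
(* H1 settles the case where c is positive, H2 the case where a is; if both
   vanish then H3 forces b to vanish. *)
have H1 := pA (c *: x + (- b) *: y).
have H2 := pA ((- b^*) *: x + a *: y).
have H3 := pA (1 *: x + (- b) *: y).
move: H1 H2 H3; rewrite !inner_quadratic// -/a -/b -/c.
rewrite !rmorphN/= conjCK aJ cJ rmorph1 normCK => H1 H2 H3.
have [c_gt0|/eqP c_0] : 0 < c \/ c == 0.
- by rewrite lt0r c0 andbT; case: eqP; [right|left].
- have : 0 <= c * (a * c - b * b^*).
    apply: le_trans H1 _; rewrite le_eqVlt; apply/orP; left; apply/eqP; ring.
  by rewrite pmulr_rge0// subr_ge0.
have [a_gt0|/eqP a_0] : 0 < a \/ a == 0.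
- by rewrite lt0r a0 andbT; case: eqP; [right|left].
- have : 0 <= a * (a * c - b * b^*).
    apply: le_trans H2 _; rewrite le_eqVlt; apply/orP; left; apply/eqP; ring.
  by rewrite pmulr_rge0// subr_ge0.
have : 0 <= - (b * b^*) *+ 2.
  apply: le_trans H3 _; rewrite a_0 c_0 le_eqVlt; apply/orP; left; apply/eqP; ring.
by rewrite pmulrn_lge0// oppr_ge0 a_0 mul0r.
Qed.

Lemma positive_op1 : positive_op (1 : {bop H}).
Proof. by split=> // x; exact: inner_ge0. Qed.

Lemma inner_CS x y : `|inner x y| <= `|x| * `|y|.
Proof.
have := positive_op_CS x y positive_op1.
rewrite !bopE -!normr_inner -exprMn ler_sqr//.
by rewrite nnegrE mulr_ge0.
Qed.

(** For c >= 0 this says that [opnorm T <= c], in a form that needs no supremum. *)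
Definition op_bound c T := forall x, `|T x| <= c%:C * `|x|.

Lemma op_bound_ex T : exists2 c, 0 <= c & op_bound c T.
Proof.
have /linear_bounded_continuous/linear_boundedP := @bop_continuous _ _ T.
move=> /pinfty_ex_gt0[r r0 Tr].
exists (complex.Re r); first by move: r0; rewrite ltcE/= => /andP[_ /ltW].
move=> x; rewrite RRe_real ?gtr0_real//; exact: Tr.
Qed.

Lemma op_boundD c d S T : op_bound c S -> op_bound d T ->
  op_bound (c + d) (S + T).
Proof.
move=> Sc Td x; rewrite bopE (le_trans (ler_normD _ _))// rmorphD/= mulrDl.
by rewrite lerD.
Qed.

Lemma op_boundN c T : op_bound c T -> op_bound c (- T).
Proof. by move=> Tc x; rewrite bopE normrN. Qed.

Lemma op_boundZ c a T : op_bound c T -> op_bound (`|a| * c) (a%:C *: T).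
Proof.
move=> Tc x; rewrite bopE normrZ rmorphM/= -mulrA.
have -> : `|a%:C| = `|a|%:C :> R[i] by rewrite normc_def/= expr0n addr0 sqrtr_sqr.
by rewrite ler_wpM2l// ler0c.
Qed.

Lemma op_boundM c d S T : 0 <= c -> op_bound c S -> op_bound d T ->
  op_bound (c * d) (S * T).
Proof.
move=> c0 Sc Td x; rewrite bopE (le_trans (Sc _))// rmorphM/= -mulrA.
by rewrite ler_wpM2l// ler0c.
Qed.

Lemma op_bound_le c d T : c <= d -> op_bound c T -> op_bound d T.
Proof.
by move=> cd Tc x; rewrite (le_trans (Tc x))// ler_wpM2r// lecR.
Qed.

Lemma Re_norm x : (complex.Re `|x|)%:C = `|x|.
Proof. by rewrite RRe_real. Qed.

Lemma opnorm_le c T : 0 <= c -> op_bound c T -> opnorm T <= c.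
Proof.
move=> c0 Tc; apply: ge_sup => [|_ [x /= x1 <-]].
  by exists (complex.Re `|T 0|); exists 0 => //=; rewrite normr0.
rewrite -lecR Re_norm (le_trans (Tc x))// -[leRHS]mulr1 ler_wpM2l//.
by rewrite ler0c.
Qed.

Lemma opnorm_bound T : op_bound (opnorm T) T.
Proof.
have [c c0 Tc] := op_bound_ex T.
have ub x : `|x| <= 1 -> complex.Re `|T x| <= opnorm T.
  move=> x1; apply: ub_le_sup; last by exists x.
  exists c => _ [y /= y1 <-].
  rewrite -lecR Re_norm (le_trans (Tc y))// -[leRHS]mulr1 ler_wpM2l//.
  by rewrite ler0c.
move=> x; have [->|x0] := eqVneq x 0; first by rewrite linear0 !normr0 mulr0.
have nx : 0 < `|x| by rewrite normr_gt0.
have := ub (`|x|^-1 *: x); rewrite normrZ normfV normr_id mulVf ?gt_eqF// => /(_ (lexx _)).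
by rewrite -lecR Re_norm linearZ/= normrZ normfV normr_id mulrC ler_pdivrMr.
Qed.

Lemma opnorm_ge0 T : 0 <= opnorm T.
Proof.
have [c c0 Tc] := op_bound_ex T.
apply: ub_le_sup; last first.
  by exists 0; rewrite /= ?normr0// linear0 normr0.
exists c => _ [y /= y1 <-].
rewrite -lecR Re_norm (le_trans (Tc y))// -[leRHS]mulr1 ler_wpM2l//.
by rewrite ler0c.
Qed.

(** For a positive operator, <A x, x> controls A x itself: a vector on which the
form is small is nearly in the kernel. *)
Lemma positive_op_sqr_le A K x : positive_op A -> op_bound K A ->
  `|A x| ^+ 2 <= K%:C * inner (A x) x.
Proof.
move=> pA KA; have [->|Ax0] := eqVneq (A x) 0.
  by rewrite normr0 expr0n/= [inner 0 x]linear0l mulr0.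
have n0 : 0 < `|A x| ^+ 2 by rewrite exprn_gt0// normr_gt0.
have := positive_op_CS x (A x) pA; rewrite -normr_inner.
rewrite [`| _ ^+ 2|]ger0_norm ?exprn_ge0// => CS.
have : inner (A (A x)) (A x) <= K%:C * `|A x| ^+ 2.
  have -> : inner (A (A x)) (A x) = `|inner (A (A x)) (A x)|.
    by rewrite ger0_norm//; exact: pA.2.
  rewrite (le_trans (inner_CS _ _))// expr2 mulrA ler_wpM2r//.
move=> /(ler_wpM2l (pA.2 x))/(le_trans CS).
by rewrite mulrCA mulrA [X in X <= _]expr2 ler_pM2r.
Qed.

End InnerProduct.

(** * Completeness and Neumann series *)

Section Completeness.
Context {R : realType} {H : hilbertType R}.
Implicit Types (x y z : H) (A S T : {bop H}) (c : R).

Lemma op_bound_bop (f : H -> H) c : linear f ->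
  (forall x, `|f x| <= c%:C * `|x|) -> exists S : {bop H}, S =1 f.
Proof.
move=> lf fc.
have cf : continuous f.
  pose g : {linear H -> H} := HB.pack f (GRing.isLinear.Build R[i] H H *:%R f lf).
  apply: (@bounded_linear_continuous _ _ _ g); apply/bounded_funP => r.
  exists (`|c%:C| * r) => x xr; rewrite (le_trans (fc x))//.
  apply: le_trans (ler_wpM2l (normr_ge0 _) xr); rewrite ler_wpM2r//.
  by rewrite real_ler_norm//; apply/complex_realP; exists c.
by exists (Bop (introT (bounded_opP _) (conj lf cf))).
Qed.

(** Bounded operators are complete in operator norm: the limit is pointwise, and
the Cauchy bound, being uniform in x, survives in the limit. *)
Lemma bop_complete (T : nat -> {bop H}) :
  (forall e : R, 0 < e -> exists N, forall k l, (N <= k)%N -> (N <= l)%N ->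
    op_bound e (T k - T l)) ->
  exists S : {bop H}, forall e : R, 0 < e -> exists N, forall k, (N <= k)%N ->
    op_bound e (T k - S).
Proof.
move=> Tcauchy.
have Tcvg x : cvgn (fun k => T k x).
  apply/cauchy_cvgP/cauchy_exP => e e0.
  have eR : e = (complex.Re e)%:C by rewrite RRe_real// gtr0_real.
  have [c c0 cx] : exists2 c : R, 0 < c & c%:C * `|x| < e.
    exists (complex.Re (e / (`|x| + 1))).
      by rewrite -ltcR RRe_real ?gtr0_real ?divr_gt0// ltr_wpDl.
    rewrite RRe_real ?gtr0_real ?divr_gt0 ?ltr_wpDl//.
    by rewrite mulrAC ltr_pdivrMr ?ltr_wpDl// ltr_pM2l// ltrDl.
  have [N TN] := Tcauchy c c0.
  exists (T N x), N => // k /= Nk; rewrite -ball_normE /=.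
  by rewrite (le_lt_trans _ cx)//; exact: TN.
pose f x := limn (fun k => T k x).
have fP x e : 0 < e -> exists N, forall k, (N <= k)%N -> `|f x - T k x| <= e.
  move=> e0; have /cvgrPdist_le/(_ e e0)[N _ NP] := Tcvg x.
  by exists N => k Nk; exact: NP.
have fE x : (fun k => T k x) @ \oo --> f x by exact: Tcvg.
have lf : linear f.
  move=> a x y; rewrite /f; apply: cvg_lim; first exact: norm_hausdorff.
  have -> : (fun k => T k (a *: x + y)) = (fun k => a *: T k x + T k y).
    by apply/funext => k; rewrite bop_argD bop_argZ.
  by apply: cvgD; [apply: cvgZl_tmp|]; exact: fE.
have fT e : 0 < e -> exists N, forall k, (N <= k)%N ->
    forall x, `|T k x - f x| <= e%:C * `|x|.
  move=> e0; have [N TN] := Tcauchy e e0; exists N => k Nk x.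
  rewrite -Re_norm -[X in _ * X]Re_norm -rmorphM/= lecR.
  apply/ler_addgt0Pr => d d0.
  have /(fP x)[N' fN'] : (0 : R[i]) < d%:C by rewrite ltcR.
  rewrite -lecR rmorphD rmorphM/= !Re_norm.
  rewrite (le_trans (ler_distD (T (maxn N N') x) _ _))// lerD//.
    apply: TN => //; exact: leq_maxl.
  by rewrite distrC; apply: fN'; exact: leq_maxr.
have [N fN] := fT 1 ltr01.
have [c c0 Tc] := op_bound_ex (T N).
have [S SE] : exists S : {bop H}, S =1 f.
  apply: (@op_bound_bop _ (1 + c)) => // x.
  rewrite rmorphD/= mulrDl.
  rewrite -[f x](subrK (T N x)) (le_trans (ler_normD _ _))// lerD// distrC.
  exact: fN.
exists S => e e0; have [N' fN'] := fT e e0; exists N' => k Nk x.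
by rewrite !bopE SE fN'.
Qed.

Lemma op_bound_eq0 T : (forall e : R, 0 < e -> op_bound e T) -> T = 0.
Proof.
move=> Te; apply: bopP => x; rewrite bopE; apply/normr0_eq0/eqP.
have n0 : 0 <= complex.Re `|x| by rewrite -ler0c Re_norm.
have n1 : 0 < complex.Re `|x| + 1 by rewrite ltr_wpDl.
have : complex.Re `|T x| <= 0.
  apply/ler_addgt0Pr => d d0; rewrite add0r -lecR Re_norm.
  apply: le_trans (Te _ (divr_gt0 d0 n1) x) _.
  rewrite -[`|x|]Re_norm -rmorphM lecR mulrAC ler_pdivrMr//.
  by rewrite ler_wpM2l ?lerDl// ltW.
move=> Tx0; rewrite normr_eq0 -normr_le0 -[X in X <= _]Re_norm.
by rewrite -[X in _ <= X]/(0%:C) lecR.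
Qed.

Definition invertible T := exists S, T * S = 1 /\ S * T = 1.

Lemma op_bound1 : op_bound 1 (1 : {bop H}).
Proof. by move=> x; rewrite bopE mul1r. Qed.

Lemma op_boundX q T k : 0 <= q -> op_bound q T -> op_bound (q ^+ k) (T ^+ k).
Proof.
move=> q0 Tq; elim: k => [|k IH]; first by rewrite !expr0; exact: op_bound1.
by rewrite !exprS; exact: op_boundM.
Qed.

(** The inverse is the sum of the powers of T; its partial sums form a Cauchy
sequence because the powers of q are summable. *)
Lemma neumann q T : 0 <= q < 1 -> op_bound q T -> invertible (1 - T).
Proof.
move=> /andP[q0 q1] Tq.
have q1' : 0 < 1 - q by rewrite subr_gt0.
pose U k := \sum_(i < k) T ^+ i.
have UE k : (1 - T) * U k = 1 - T ^+ k.
  rewrite /U -[in RHS](expr1n _ k) (subrXX_comm _ (commr_sym (commr1 _))).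
  by congr (_ * _); apply: eq_bigr => i _; rewrite expr1n mul1r.
have UE' k : U k * (1 - T) = 1 - T ^+ k.
  rewrite -UE mulr_suml mulr_sumr; apply: eq_bigr => i _.
  by rewrite mulrBl mulrBr mulr1 mul1r -exprS -exprSr.
have Ub k l : (k <= l)%N -> op_bound (q ^+ k / (1 - q)) (U l - U k).
  move=> kl.
  have : op_bound ((q ^+ k - q ^+ l) / (1 - q)) (U l - U k).
    elim: l kl => [|l IH].
      by rewrite leqn0 => /eqP->; rewrite !subrr mul0r => x; rewrite bopE normr0 mul0r.
    rewrite leq_eqVlt => /predU1P[->|/IH{}IH].
      by rewrite !subrr mul0r => x; rewrite bopE normr0 mul0r.
    have -> : U l.+1 - U k = (U l - U k) + T ^+ l by rewrite /U big_ord_recr/= addrAC.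
    have -> : (q ^+ k - q ^+ l.+1) / (1 - q) = (q ^+ k - q ^+ l) / (1 - q) + q ^+ l.
      by rewrite exprS; field; exact: lt0r_neq0.
    by apply: op_boundD => //; exact: op_boundX.
  apply: op_bound_le; rewrite ler_pM2r ?invr_gt0// gerBl exprn_ge0//.
have qk e : 0 < e -> exists N, forall k, (N <= k)%N -> q ^+ k <= e.
  move=> e0; have : (fun k => q ^+ k) @ \oo --> (0 : R).
    by apply: cvg_expr; rewrite ger0_norm.
  move=> /cvgrPdist_le/(_ e e0)[N _ NP]; exists N => k /NP/=.
  by rewrite sub0r normrN ger0_norm// exprn_ge0.
have [S SP] : exists S : {bop H}, forall e : R, 0 < e -> exists N, forall k,
    (N <= k)%N -> op_bound e (U k - S).
  apply: bop_complete => e e0.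
  have [N NP] := qk _ (mulr_gt0 e0 q1'); exists N => k l Nk Nl.
  wlog kl : k l Nk Nl / (k <= l)%N => [WL|].
    have /orP[kl|lk] := leq_total k l; first exact: WL.
    by rewrite -opprB; apply: op_boundN; exact: WL.
  rewrite -opprB; apply: op_boundN; apply: op_bound_le (Ub _ _ kl).
  by rewrite ler_pdivrMr// NP.
have [c c0 Tc] := op_bound_ex (1 - T).
have c1 : 0 < c + 1 by rewrite ltr_wpDl.
(* V is left or right multiplication by 1 - T; both are continuous, so they
   carry the limit S of the partial sums U k to the limit 1 of 1 - T ^+ k. *)
have main (V : {bop H} -> {bop H}) :
    (forall d X, 0 <= d -> op_bound d X -> op_bound ((c + 1) * d) (V X)) ->
    {morph V : X Y / X - Y} ->
    (forall k, V (U k) = 1 - T ^+ k) -> V S = 1.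
  move=> Vb VB VU; apply/eqP; rewrite -subr_eq0; apply/eqP.
  apply: op_bound_eq0 => e e0.
  have e1 : 0 < e / 2 / (c + 1) by rewrite !divr_gt0.
  have [N1 N1P] := SP _ e1.
  have [N2 N2P] := qk (e / 2) (divr_gt0 e0 (ltr0Sn _ 1)).
  pose k := maxn N1 N2.
  have -> : V S - 1 = - (V (U k - S)) + (- T ^+ k).
    by rewrite VB VU opprB -addrA -opprD subrK.
  rewrite (splitr e); apply: op_boundD; apply: op_boundN.
    have -> : e / 2 = (c + 1) * (e / 2 / (c + 1)) by field; exact: lt0r_neq0.
    by apply: Vb; [exact: ltW|apply: N1P; exact: leq_maxl].
  apply: op_bound_le (op_boundX _ q0 Tq); apply: N2P; exact: leq_maxr.
exists S; split.
  apply: (main (fun X => (1 - T) * X)) => [d X d0 Xd|X Y|k]; last exact: UE.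
    by apply: op_boundM; [exact: ltW| |done]; apply: op_bound_le Tc; rewrite lerDl.
  by rewrite mulrBr.
apply: (main (fun X => X * (1 - T))) => [d X d0 Xd|X Y|k]; last exact: UE'.
  by rewrite mulrC; apply: op_boundM => //; apply: op_bound_le Tc; rewrite lerDl.
by rewrite mulrBl.
Qed.

End Completeness.

(** * Polynomials of an operator and the spectrum *)

Section PolynomialCalculus.
Context {R : realType} {H : hilbertType R}.
Implicit Types (x y : H) (A S T X Y : {bop H}) (p q : {poly R[i]}).

Lemma bop_scalerAl a S T : a *: (S * T) = (a *: S) * T.
Proof. by apply: bopP => x; rewrite !bopE. Qed.

Lemma bop_scalerAr a S T : a *: (S * T) = S * (a *: T).
Proof. by apply: bopP => x; rewrite !bopE bop_argZ. Qed.

(** Complex coefficients allow a polynomial to split into linear factors. *)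
Definition cpoly_op p T : {bop H} := \sum_(i < size p) p`_i *: T ^+ i.

Lemma cpoly_op_widen n p T : (size p <= n)%N ->
  cpoly_op p T = \sum_(i < n) p`_i *: T ^+ i.
Proof.
move=> pn; rewrite /cpoly_op (big_ord_widen n (fun i => p`_i *: T ^+ i))//.
rewrite big_mkcond; apply: eq_bigr => i _; case: ltnP => // pi.
by rewrite nth_default// scale0r.
Qed.

Lemma cpoly_opD p q T : cpoly_op (p + q) T = cpoly_op p T + cpoly_op q T.
Proof.
pose n := maxn (size p) (size q).
rewrite (@cpoly_op_widen n) ?size_polyD//.
rewrite (@cpoly_op_widen n p) ?leq_maxl// (@cpoly_op_widen n q) ?leq_maxr//.
by rewrite -big_split/=; apply: eq_bigr => i _; rewrite coefD scalerDl.
Qed.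

Lemma cpoly_opZ a p T : cpoly_op (a *: p) T = a *: cpoly_op p T.
Proof.
rewrite (@cpoly_op_widen (size p)) ?size_scale_leq// /cpoly_op scaler_sumr.
by apply: eq_bigr => i _; rewrite coefZ scalerA.
Qed.

Lemma cpoly_opC a T : cpoly_op a%:P T = scalar_op a.
Proof.
by rewrite (@cpoly_op_widen 1) ?size_polyC_leq1// big_ord1 coefC expr0.
Qed.

Lemma cpoly_op_MXaddC p a T :
  cpoly_op (p * 'X + a%:P) T = cpoly_op p T * T + scalar_op a.
Proof.
rewrite (@cpoly_op_widen (size p).+1); last first.
  by rewrite size_MXaddC; case: ifP.
rewrite big_ord_recl/= addrC coefD coefMX coefC/= add0r expr0; congr (_ + _).
rewrite /cpoly_op mulr_suml; apply: eq_bigr => i _.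
by rewrite coefD coefMX coefC/= addr0 -bop_scalerAl exprSr.
Qed.

Lemma cpoly_op_comm p T : cpoly_op p T * T = T * cpoly_op p T.
Proof.
rewrite mulr_suml mulr_sumr; apply: eq_bigr => i _.
by rewrite -bop_scalerAl -bop_scalerAr -exprSr exprS.
Qed.

Lemma cpoly_opM p q T : cpoly_op (p * q) T = cpoly_op p T * cpoly_op q T.
Proof.
elim/poly_ind: p => [|p c IH].
  by rewrite mul0r -(scale0r 0) cpoly_opZ scale0r mul0r.
have -> : (p * 'X + c%:P) * q = (p * q * 'X + 0%:P) + c *: q.
  by rewrite mulrDl addr0 mulrAC mul_polyC.
rewrite cpoly_opD cpoly_opZ !cpoly_op_MXaddC IH mulrDl -!mulrA cpoly_op_comm.
by rewrite /scalar_op scale0r addr0 -bop_scalerAl mul1r.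
Qed.

Lemma cpoly_op_XsubC a T : cpoly_op ('X - a%:P) T = T - scalar_op a.
Proof.
rewrite -polyCN -[X in X + _]mul1r cpoly_op_MXaddC -[1]/(1%:P) cpoly_opC.
by rewrite /scalar_op scale1r mul1r scaleNr.
Qed.

Lemma invertible1 : invertible (1 : {bop H}).
Proof. by exists 1; rewrite mulr1. Qed.

Lemma invertibleM S T : invertible S -> invertible T -> invertible (S * T).
Proof.
move=> [S' [SS' S'S]] [T' [TT' T'T]]; exists (T' * S'); split.
  by rewrite mulrA -(mulrA S) TT' mulr1.
by rewrite mulrA -(mulrA T') S'S mulr1.
Qed.

Lemma invertibleZ a T : a != 0 -> invertible T -> invertible (a *: T).
Proof.
move=> a0 [T' [TT' T'T]]; exists (a^-1 *: T'); split.
  by rewrite -bop_scalerAl -bop_scalerAr scalerA mulfV// scale1r.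
by rewrite -bop_scalerAl -bop_scalerAr scalerA mulVf// scale1r.
Qed.

Lemma invertible_comml S T : S * T = T * S -> invertible (S * T) -> invertible S.
Proof.
move=> ST [U [STU UST]]; have lS : U * T * S = 1 by rewrite -mulrA -ST.
have rS : S * (T * U) = 1 by rewrite mulrA.
exists (T * U); split => //.
by rewrite -[T * U]mul1r -lS -(mulrA (U * T)) rS mulr1.
Qed.

(** Spectral mapping: p - z splits into linear factors, and p(T) - z is
invertible if every factor T - w is.  The nonempty spectrum covers the constant
polynomial z, which has no factor. *)
Lemma spectrum_cpoly p T z : (exists w, spectrum T w) ->
  spectrum (cpoly_op p T) z -> exists2 w, spectrum T w & p.[w] = z.
Proof.
move=> [w0 w0T] zp; apply: contrapT => nex; apply: zp.
pose q := p - z%:P.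
have qE w : p.[w] = q.[w] + z by rewrite /q !hornerE subrK.
have -> : cpoly_op p T - scalar_op z = cpoly_op q T.
  by rewrite /q -polyCN cpoly_opD cpoly_opC /scalar_op scaleNr.
have q0 : q != 0.
  apply/eqP => q0; apply: nex; exists w0 => //.
  by rewrite qE q0 horner0 add0r.
have [r qr] := closed_field_poly_normal q.
have rT w : w \in r -> invertible (T - scalar_op w).
  move=> wr; apply: contrapT => wT; apply: nex; exists w => //.
  by rewrite qE qr hornerZ (rootP _) ?mulr0 ?add0r// root_prod_XsubC.
rewrite qr cpoly_opZ; apply: invertibleZ; first by rewrite lead_coef_eq0.
elim: r rT {qr} => [|w r IH] rT.
  by rewrite big_nil -[1]/(1%:P) cpoly_opC /scalar_op scale1r; exact: invertible1.
rewrite big_cons cpoly_opM cpoly_op_XsubC; apply: invertibleM.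
  by apply: rT; rewrite inE eqxx.
by apply: IH => v vr; apply: rT; rewrite inE vr orbT.
Qed.

Lemma poly_opE (p : {poly R}) T :
  poly_op p T = cpoly_op (map_poly (real_complex R) p) T.
Proof.
rewrite /cpoly_op size_map_poly; apply: eq_bigr => i _.
by rewrite coef_map.
Qed.

End PolynomialCalculus.

(** * Positivity and the spectrum of self-adjoint operators *)

Section SelfAdjoint.
Context {R : realType} {H : hilbertType R}.
Implicit Types (x y : H) (A S T X Y : {bop H}) (a c d m M t : R).

Lemma selfadjointD S T : selfadjoint S -> selfadjoint T -> selfadjoint (S + T).
Proof. by move=> sS sT x y; rewrite !bopE innerDl innerDr sS sT. Qed.

Lemma selfadjointZ a T : selfadjoint T -> selfadjoint (a%:C *: T).
Proof.
by move=> sT x y; rewrite !bopE innerZl innerZr sT [_^*]conjc_real.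
Qed.

Lemma selfadjoint1 : selfadjoint (1 : {bop H}).
Proof. by []. Qed.

Lemma selfadjoint0 : selfadjoint (0 : {bop H}).
Proof. by move=> x y; rewrite bopE [LHS]linear0l [RHS]linear0r. Qed.

Lemma selfadjoint_scalar a : selfadjoint (scalar_op a%:C : {bop H}).
Proof. exact/selfadjointZ/selfadjoint1. Qed.

Lemma selfadjointN T : selfadjoint T -> selfadjoint (- T).
Proof. by move=> sT x y; rewrite !bopE innerNl innerNr sT. Qed.

Lemma selfadjointX T k : selfadjoint T -> selfadjoint (T ^+ k).
Proof.
move=> sT; elim: k => [|k IH] x y; first by rewrite expr0.
by rewrite {1}exprSr exprS !bop_mulE IH sT.
Qed.

Lemma selfadjoint_poly (p : {poly R}) T : selfadjoint T -> selfadjoint (poly_op p T).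
Proof.
move=> sT; rewrite /poly_op; elim/big_ind: _ => [|S U|i _].
- exact: selfadjoint0.
- exact: selfadjointD.
- exact/selfadjointZ/selfadjointX.
Qed.

Lemma selfadjoint_real A x : selfadjoint A ->
  (complex.Re (inner (A x) x))%:C = inner (A x) x.
Proof.
move=> sA; rewrite RRe_real//; apply/CrealP.
by rewrite -[LHS]innerC -sA.
Qed.

Lemma positive_opD S T : positive_op S -> positive_op T -> positive_op (S + T).
Proof.
move=> [sS pS] [sT pT]; split; first exact: selfadjointD.
by move=> x; rewrite bopE innerDl addr_ge0.
Qed.

Lemma positive_opZ a T : 0 <= a -> positive_op T -> positive_op (a%:C *: T).
Proof.
move=> a0 [sT pT]; split; first exact: selfadjointZ.
by move=> x; rewrite bopE innerZl mulr_ge0// ler0c.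
Qed.

Lemma positive_op0 : positive_op (0 : {bop H}).
Proof. by split; [exact: selfadjoint0|move=> x; rewrite bopE [inner _ _]linear0l]. Qed.

(** Cauchy-Schwarz for the form of T, between x and T x, gives
|T x|^4 <= (q |x|^2) (q |T x|^2). *)
Lemma positive_op_bound q T : 0 <= q -> positive_op T ->
  positive_op (scalar_op q%:C - T) -> op_bound q T.
Proof.
move=> q0 pT [_ qT] x.
have qTx y : inner (T y) y <= q%:C * `|y| ^+ 2.
  by have := qT y; rewrite !bopE innerDl innerNl innerZl -normr_inner subr_ge0.
have [->|Tx0] := eqVneq (T x) 0; first by rewrite normr0 mulr_ge0// ler0c.
have n0 : 0 < `|T x| ^+ 2 by rewrite exprn_gt0// normr_gt0.
rewrite -ler_sqr ?nnegrE ?mulr_ge0 ?ler0c//.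
rewrite -(ler_pM2r n0) -expr2.
have := positive_op_CS x (T x) pT; rewrite -normr_inner normrX normr_id.
move=> /le_trans; apply.
have -> : (q%:C * `|x|) ^+ 2 * `|T x| ^+ 2 =
  (q%:C * `|x| ^+ 2) * (q%:C * `|T x| ^+ 2) by ring.
by rewrite ler_pM ?pT.2.
Qed.

(** If d <= A <= K then 1 - A / K is between 0 and 1 - d / K < 1, so A is K
times the sum of a Neumann series. *)
Lemma positive_op_invertible A d : 0 < d ->
  positive_op (A - scalar_op d%:C) -> invertible A.
Proof.
move=> d0 pA.
have [c c0 Ac] := op_bound_ex A.
pose K := c + d.
have K0 : 0 < K by rewrite ltr_wpDl.
have sA : selfadjoint A.
  rewrite -(subrK (scalar_op d%:C) A); apply: selfadjointD pA.1 _.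
  exact: selfadjoint_scalar.
have pK : positive_op (scalar_op K%:C - A).
  split; first exact/selfadjointD/selfadjointN/sA/selfadjoint_scalar.
  move=> x; rewrite !bopE innerDl innerNl innerZl -normr_inner subr_ge0.
  have le_norm : inner (A x) x <= `|inner (A x) x|.
    rewrite -[X in X <= _]selfadjoint_real// (le_trans _ (normc_ge_Re _))//.
    by rewrite lecR ler_norm.
  rewrite (le_trans le_norm)// (le_trans (inner_CS _ _))// expr2 mulrA ler_wpM2r//.
  by apply: op_bound_le Ac _; rewrite lerDl ltW.
pose T := 1 - K^-1%:C *: A.
have TE : T = K^-1%:C *: (scalar_op K%:C - A).
  rewrite /T scalerBr /scalar_op scalerA -rmorphM/= mulVf ?gt_eqF//.
  by rewrite scale1r.
have qK : 0 <= 1 - d / K < 1.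
  by rewrite subr_ge0 ler_pdivrMr// mul1r lerDr c0 gtrBl divr_gt0.
have Tq : op_bound (1 - d / K) T.
  apply: positive_op_bound; first by case/andP: qK.
    by rewrite TE; apply: positive_opZ => //; rewrite invr_ge0 ltW.
  have -> : scalar_op (1 - d / K)%:C - T = K^-1%:C *: (A - scalar_op d%:C).
    rewrite /T /scalar_op scalerBr scalerA -rmorphM/= opprB addrC -!addrA; congr (_ + _).
    by rewrite rmorphB/= scalerBl scale1r addrA addNr sub0r mulrC.
  by apply: positive_opZ => //; rewrite invr_ge0 ltW.
have -> : A = K%:C *: (1 - T).
  by rewrite /T subKr scalerA -rmorphM/= mulfV ?gt_eqF// scale1r.
apply: invertibleZ; first by rewrite -[0]/(0%:C) (inj_eq (@complexI _)) gt_eqF.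
exact: neumann Tq.
Qed.

(** The bound |x| <= s |A x| from the inverse, together with
|A x|^2 <= K <A x, x>, bounds the form below. *)
Lemma invertible_positive_op A : positive_op A -> invertible A ->
  exists2 d, 0 < d & positive_op (A - scalar_op d%:C).
Proof.
move=> pA [S [AS SA]].
have [K K0 AK] := op_bound_ex A.
have [s s0 Ss] := op_bound_ex S.
(* The summand 1 only ensures that C is positive. *)
pose C := s ^+ 2 * K + 1.
have C0 : 0 < C by rewrite ltr_wpDl// mulr_ge0// exprn_ge0.
exists C^-1; first by rewrite invr_gt0.
split; first exact/selfadjointD/selfadjointN/selfadjoint_scalar/pA.1.
move=> x; rewrite !bopE innerDl innerNl innerZl -normr_inner subr_ge0.
rewrite fmorphV/= ler_pdivrMl ?ltcR//.
have Sx : `|x| <= s%:C * `|A x|.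
  by have := Ss (A x); rewrite -bop_mulE SA.
have : `|x| ^+ 2 <= (s%:C * `|A x|) ^+ 2.
  by rewrite ler_sqr ?nnegrE ?mulr_ge0 ?ler0c.
move=> /le_trans; apply; rewrite exprMn /C rmorphD rmorphM rmorphXn/=.
rewrite mulrDl mul1r ler_wpDr ?pA.2// -[leRHS]mulrA.
by rewrite ler_wpM2l ?exprn_ge0 ?ler0c// positive_op_sqr_le.
Qed.

(** The witness is the infimum of the numerical range: if A - a were invertible,
it would be bounded below by some d > 0 and a + d would be a lower bound too.
The vector x says that the space is nonzero; otherwise the spectrum is empty. *)
Lemma spectrum_inf A x : selfadjoint A -> x != 0 ->
  exists a : R, spectrum A a%:C /\ positive_op (A - scalar_op a%:C).
Proof.
move=> sA x0.
pose E := [set complex.Re (inner (A y) y) | y in [set y : H | `|y| = 1]].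
have [c c0 Ac] := op_bound_ex A.
have Elb : lbound E (- c).
  move=> _ [y /= y1 <-].
  have : `|inner (A y) y| <= c%:C.
    rewrite (le_trans (inner_CS _ _))// y1 mulr1.
    by have := Ac y; rewrite y1 mulr1.
  move=> /(le_trans (normc_ge_Re _)); rewrite lecR ler_norml.
  by move=> /andP[].
have unitv y : y != 0 -> `| (`|y|^-1 *: y) | = 1.
  by move=> y0; rewrite normrZ normfV normr_id mulVf// normr_eq0.
have E0 : E !=set0.
  exists (complex.Re (inner (A (`|x|^-1 *: x)) (`|x|^-1 *: x))).
  by exists (`|x|^-1 *: x); rewrite /= ?unitv.
have hasE : has_inf E by split=> //; exists (- c).
have lbP d : lbound E d -> positive_op (A - scalar_op d%:C).
  move=> Ed; split; first exact/selfadjointD/selfadjointN/selfadjoint_scalar/sA.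
  move=> y; rewrite !bopE innerDl innerNl innerZl -normr_inner subr_ge0.
  have [->|y0] := eqVneq y 0.
    by rewrite normr0 expr0n mulr0 [inner _ _]linear0r.
  have : d <= complex.Re (inner (A (`|y|^-1 *: y)) (`|y|^-1 *: y)).
    by apply: Ed; exists (`|y|^-1 *: y) => //=; rewrite unitv.
  rewrite -lecR selfadjoint_real// bop_argZ innerZl innerZr.
  have -> : (`|y|^-1)^* = `|y|^-1 by apply/CrealP; rewrite ger0_real// invr_ge0.
  rewrite mulrA -invfM -expr2 ler_pdivlMl ?exprn_gt0 ?normr_gt0//.
  by rewrite mulrC.
have infE : lbound E (inf E) by move=> r Er; apply: ge_inf => //; exists (- c).
exists (inf E); split; last exact: lbP.
move=> /(invertible_positive_op (lbP _ infE))[d d0 pd].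
have /(inf_adherent d0)[_ [y /= y1 <-]] := hasE.
have := pd.2 y; rewrite !bopE !innerDl !innerNl !innerZl -normr_inner y1 expr1n.
rewrite !mulr1 -selfadjoint_real// -!rmorphB/= ler0c subr_ge0 lerBrDr.
move=> /le_lt_trans H1 /H1; by rewrite addrC ltxx.
Qed.

(** The infimum of the numerical range of p(T) is in the spectrum of p(T), hence
a value of p on the spectrum of T. *)
Lemma poly_op_positive (p : {poly R}) T : selfadjoint T ->
  spectrum T `<=` [set t%:C | t in [set: R]] ->
  (forall t, spectrum T t%:C -> 0 <= p.[t]) -> positive_op (poly_op p T).
Proof.
move=> sT Treal p0; have sp := selfadjoint_poly p sT; split=> // x.
have [->|x0] := eqVneq x 0; first by rewrite [inner _ _]linear0r.
have [a [ap pa]] := spectrum_inf sp x0.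
have [b [bT _]] := spectrum_inf sT x0.
rewrite poly_opE in ap.
have [w wT pw] := spectrum_cpoly (ex_intro _ _ bT) ap.
have [t _ tw] := Treal w wT; rewrite -tw in wT pw.
move: pw; rewrite horner_map => /complexI pa'.
have a0 : 0 <= a by rewrite -pa'; exact: p0.
have := pa.2 x; rewrite !bopE innerDl innerNl innerZl subr_ge0.
by apply: le_trans; rewrite mulr_ge0 ?inner_ge0// ler0c.
Qed.

Lemma poly_op_spectrum (p : {poly R}) T z : selfadjoint T ->
  spectrum T `<=` [set t%:C | t in [set: R]] ->
  spectrum (poly_op p T) z -> exists2 t, spectrum T t%:C & z = (p.[t])%:C.
Proof.
move=> sT Treal zp.
have [w wT] : exists w, spectrum T w.
  have [x x0] : exists x : H, x != 0.
    apply: contrapT => nx; apply: zp; exists 0.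
    split; apply: bopP => y; have [->|y0] := eqVneq y 0;
      by rewrite ?bop_mulE ?linear0//; case: nx; exists y.
  by have [a [aT _]] := spectrum_inf sT x0; exists a%:C.
rewrite poly_opE in zp.
have [v vT pv] := spectrum_cpoly (ex_intro _ _ wT) zp.
have [t _ tv] := Treal v vT; exists t; first by rewrite tv.
by rewrite -pv -tv horner_map.
Qed.

(** For z = a + ib with b nonzero, (A - z)(A - conj z) = (A - a)^2 + b^2 is
bounded below by b^2, so A - z is invertible; for a real z outside [m, M],
A - z or z - A is itself bounded below. *)
Lemma spectrum_segment A m M : positive_op (A - scalar_op m%:C) ->
  positive_op (scalar_op M%:C - A) -> sa_spec `[m, M] A.
Proof.
move=> pm pM.
have sA : selfadjoint A.
  rewrite -(subrK (scalar_op m%:C) A); apply: selfadjointD pm.1 _.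
  exact: selfadjoint_scalar.
split=> // -[a b] zA.
have b0 : b = 0.
  apply: contrapT => /eqP b0; apply: zA.
  pose z := a +i* b; rewrite -/z.
  apply: (@invertible_comml _ _ _ (A - scalar_op (z^*)%R)).
    by rewrite -!cpoly_op_XsubC -!cpoly_opM mulrC.
  apply: (@positive_op_invertible _ (b ^+ 2)); first by rewrite exprn_even_gt0.
  have adj x y : inner ((A - scalar_op z) x) y = inner x ((A - scalar_op (z^*)%R) y).
    by rewrite !bopE innerDl innerDr innerNl innerNr innerZl innerZr conjCK sA.
  have adj' x y : inner ((A - scalar_op (z^*)%R) x) y = inner x ((A - scalar_op z) y).
    by rewrite !bopE innerDl innerDr innerNl innerNr innerZl innerZr sA.
  split=> [x y|x].
    rewrite !bop_subE innerDl innerDr innerNl innerNr !scalar_opE innerZl innerZr.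
    rewrite [((b ^+ 2)%:C)^*]conjc_real; congr (_ - _).
    by rewrite !bop_mulE adj adj'.
  rewrite bop_subE innerDl innerNl scalar_opE innerZl bop_mulE adj.
  pose c : R[i] := 0 +i* b; pose u := (A - scalar_op a%:C) x.
  have cJ : c^* = - c by apply/eqP; rewrite eq_complex /= oppr0 !eqxx.
  have cc : c * c = - (b ^+ 2)%:C.
    by apply/eqP; rewrite eq_complex /= !mul0r mulr0 sub0r addr0 oppr0 expr2 !eqxx.
  have -> : (A - scalar_op (z^*)%R) x = u + c *: x.
    rewrite !bopE -addrA -scaleNr -scaleNr -scalerDl; congr (_ + _ *: _).
    by apply/eqP; rewrite eq_complex /= opprK addr0 oppr0 add0r !eqxx.
  have xu : inner x u = inner u x.
    have sAa : selfadjoint (A - scalar_op a%:C).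
      exact/selfadjointD/selfadjointN/selfadjoint_scalar/sA.
    by rewrite -sAa.
  clearbody u.
  rewrite innerDl !innerDr !innerZl !innerZr cJ xu.
  have -> : forall U V W : R[i],
      U + - c * V + (c * V + c * (- c * W)) - (b ^+ 2)%:C * W =
      U + - (c * c + (b ^+ 2)%:C) * W by move=> *; ring.
  by rewrite cc addNr oppr0 mul0r addr0 inner_ge0.
exists a; last by rewrite b0.
rewrite b0 complexr0 in zA.
rewrite /= in_itv/=; apply/andP; split; rewrite leNgt; apply/negP => am; apply: zA.
  apply: (@positive_op_invertible _ (m - a)); first by rewrite subr_gt0.
  by rewrite rmorphB/= /scalar_op scalerBl opprB addrA subrK.
rewrite -opprB -scaleN1r; apply: invertibleZ; first by rewrite oppr_eq0 oner_eq0.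
apply: (@positive_op_invertible _ (a - M)); first by rewrite subr_gt0.
by rewrite rmorphB/= /scalar_op scalerBl opprB addrC addrA subrK.
Qed.

End SelfAdjoint.

(** * Continuous functional calculus *)

Section ContinuousCalculus.
Context {R : realType} {H : hilbertType R}.
Implicit Types (x y : H) (A S T : {bop H}) (f g : R -> R) (p q : {poly R}).
Implicit Types (a b c e m M t : R).

Lemma poly_opD p q T : poly_op (p + q) T = poly_op p T + poly_op q T.
Proof. by rewrite !poly_opE rmorphD/= cpoly_opD. Qed.

Lemma poly_opZ a p T : poly_op (a *: p) T = a%:C *: poly_op p T.
Proof. by rewrite !poly_opE map_polyZ/= cpoly_opZ. Qed.

Lemma poly_opC a T : poly_op a%:P T = scalar_op a%:C.
Proof. by rewrite poly_opE map_polyC/= cpoly_opC. Qed.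

Lemma poly_opM p q T : poly_op (p * q) T = poly_op p T * poly_op q T.
Proof. by rewrite !poly_opE rmorphM/= cpoly_opM. Qed.

Lemma poly_op_XsubC a T : poly_op ('X - a%:P) T = T - scalar_op a%:C.
Proof. by rewrite poly_opE map_polyXsubC cpoly_op_XsubC. Qed.

Lemma poly_opN p T : poly_op (- p) T = - poly_op p T.
Proof. by rewrite -[- p]scaleN1r poly_opZ rmorphN1 scaleN1r. Qed.

Lemma poly_op_comp p q T : poly_op (p \Po q) T = poly_op p (poly_op q T).
Proof.
elim/poly_ind: p => [|p c IH].
  by rewrite comp_poly0 -[0]/(0%:P) !poly_opC.
rewrite comp_poly_MXaddC poly_opD poly_opM IH poly_opC.
by rewrite [RHS]poly_opE rmorphD rmorphM/= map_polyX map_polyC/= cpoly_op_MXaddC -poly_opE.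
Qed.

Lemma sa_spec_real (J : set R) T : sa_spec J T ->
  spectrum T `<=` [set t%:C | t in [set: R]].
Proof. by move=> [_ TJ] z /TJ[t _ <-]; exists t. Qed.

Lemma sa_spec_in (J : set R) T t : sa_spec J T -> spectrum T t%:C -> J t.
Proof. by move=> [_ TJ] /TJ[s Js /complexI <-]. Qed.

(** The operator c^2 - p(T)^2 is positive, and <p(T)^2 x, x> = |p(T) x|^2. *)
Lemma poly_op_bound (J : set R) p T c : sa_spec J T -> 0 <= c ->
  (forall t, spectrum T t%:C -> `|p.[t]| <= c) -> op_bound c (poly_op p T).
Proof.
move=> TJ c0 pc x; have sT := TJ.1.
have [_ /(_ x)] : positive_op (poly_op ((c ^+ 2)%:P - p * p) T).
  apply: poly_op_positive => // [|t tT]; first exact: sa_spec_real TJ.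
  rewrite !hornerE subr_ge0 -expr2 -[leLHS]real_normK ?num_real//.
  by rewrite ler_sqr ?nnegrE// pc.
rewrite poly_opD poly_opN poly_opM poly_opC !bopE innerDl innerNl innerZl.
rewrite (selfadjoint_poly p sT) -!normr_inner subr_ge0 rmorphXn/= -exprMn.
by rewrite ler_sqr ?nnegrE ?mulr_ge0 ?ler0c.
Qed.

Lemma uniform_cvgP (D : set R) (u : nat -> R -> R) f :
  {uniform D, u @ \oo --> f} <->
  forall e, 0 < e -> exists N, forall k, (N <= k)%N ->
    forall t, D t -> `|u k t - f t| <= e.
Proof.
split=> [uf e e0|uf P].
  have /uf : nbhs (f : {uniform` D -> R}) [set h | forall t, D t -> `|h t - f t| <= e].
    apply/uniform_nbhs; exists [set xy : R * R | ball xy.1 e xy.2].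
    split; first exact: entourage_ball (PosNum e0).
    by move=> h /= hD t Dt; rewrite distrC ltW//; exact: hD.
  by move=> [N _ NP]; exists N => k /NP.
move=> /uniform_nbhs[E [+ EP]].
rewrite -entourage_ballE => -[e /= e0 eE].
have [N NP] := uf (e / 2) (divr_gt0 e0 (ltr0Sn _ 1)).
exists N => // k /= Nk; apply: EP => t Dt /=; apply: eE.
rewrite /ball /= distrC (le_lt_trans (NP k Nk t Dt))//.
by rewrite ltr_pdivrMr// ltr_pMr// ltrDl.
Qed.

Lemma is_cfc_bound f T S : is_cfc f T S ->
  forall p : nat -> {poly R},
  (forall e, 0 < e -> exists N, forall k, (N <= k)%N ->
    forall t, spectrum T t%:C -> `|(p k).[t] - f t| <= e) ->
  forall e, 0 < e -> exists N, forall k, (N <= k)%N ->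
    op_bound e (poly_op (p k) T - S).
Proof.
move=> fTS p /uniform_cvgP/fTS/cvgrPdist_le pS e e0.
have [N _ NP] := pS e e0; exists N => k Nk.
apply: op_bound_le (opnorm_bound _).
have := NP k Nk; rewrite sub0r normrN; apply: le_trans; exact: ler_norm.
Qed.

(** The sequences q of the definition converge on the spectrum only, whereas the
sequence p that produces the limit converges on all of [m, M]; their difference
tends to 0 on the spectrum, which is what [poly_op_bound] needs. *)
Lemma cfc_is_cfc m M f T : m < M -> sa_spec `[m, M] T ->
  {within `[m, M], continuous f} -> is_cfc f T (cfc f T).
Proof.
move=> mM TmM fc.
have TP t : spectrum T t%:C -> t \in `[m, M] by move=> /(sa_spec_in TmM).
have [p pf] := weierstrass_seq mM fc.
have pq (q q' : {poly R}) (d d' : R) : 0 <= d -> 0 <= d' ->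
    (forall t, spectrum T t%:C -> `|q.[t] - f t| <= d) ->
    (forall t, spectrum T t%:C -> `|q'.[t] - f t| <= d') ->
    op_bound (d + d') (poly_op q T - poly_op q' T).
  move=> d0 d'0 qf q'f; rewrite -poly_opN -poly_opD.
  apply: poly_op_bound TmM _ _ => [|t tT]; first exact: addr_ge0.
  rewrite !hornerE (le_trans (ler_distD (f t) _ _))// lerD ?qf// distrC.
  exact: q'f.
have [S SP] : exists S : {bop H}, forall e : R, 0 < e -> exists N, forall k,
    (N <= k)%N -> op_bound e (poly_op (p k) T - S).
  apply: bop_complete => e e0; have [N NP] := pf (e / 2) (divr_gt0 e0 (ltr0Sn _ 1)).
  exists N => k l Nk Nl; rewrite (splitr e).
  by apply: pq; rewrite ?divr_ge0 ?(ltW e0)// => t /TP; exact: NP.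
apply: (@xgetPex _ 0 [set S | is_cfc f T S]); exists S => q /uniform_cvgP qf.
apply/cvgrPdist_le => e e0.
have e3 : 0 < e / 3 by rewrite divr_gt0.
have [N1 N1P] := qf _ e3; have [N2 N2P] := SP _ e3; have [N3 N3P] := pf _ e3.
exists N1 => // k /= Nk; rewrite sub0r normrN ger0_norm ?opnorm_ge0//.
apply: opnorm_le; first exact: ltW.
pose l := maxn N2 N3.
have -> : poly_op (q k) T - S =
    (poly_op (q k) T - poly_op (p l) T) + (poly_op (p l) T - S).
  by rewrite addrA subrK.
have -> : e = (e / 3 + e / 3) + e / 3 by field.
apply: op_boundD; last by apply: N2P; exact: leq_maxl.
apply: pq; rewrite ?(ltW e3)// => t tT; first exact: N1P.
by apply: N3P (TP t tT); exact: leq_maxr.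
Qed.

(** S is g(T), witnessed by polynomials that approximate g on all of [m, M].
Unlike [cfc], this is a relation, so it passes to linear combinations without
uniqueness of the limit or continuity of g. *)
Definition fcalc m M T g S := forall e, 0 < e -> exists p,
  (forall t, t \in `[m, M] -> `|p.[t] - g t| <= e) /\
  op_bound e (poly_op p T - S).

Lemma fcalc_cfc m M T f : m < M -> sa_spec `[m, M] T ->
  {within `[m, M], continuous f} -> fcalc m M T f (cfc f T).
Proof.
move=> mM TmM fc e e0.
have [p pf] := weierstrass_seq mM fc.
have /(is_cfc_bound (cfc_is_cfc mM TmM fc))/(_ e e0)[N NP] :
    forall d, 0 < d -> exists N, forall k, (N <= k)%N ->
      forall t, spectrum T t%:C -> `|(p k).[t] - f t| <= d.
  move=> d d0; have [N NP] := pf d d0; exists N => k Nk t /(sa_spec_in TmM).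
  exact: NP.
have [N' NP'] := pf e e0.
exists (p (maxn N N')); split; last by apply: NP; exact: leq_maxl.
by apply: NP'; exact: leq_maxr.
Qed.

Lemma fcalc_poly m M T p : fcalc m M T (fun t => p.[t]) (poly_op p T).
Proof.
move=> e e0; exists p; split=> [t _|x]; first by rewrite subrr normr0 ltW.
by rewrite subrr bopE normr0 mulr_ge0// ler0c ltW.
Qed.

Lemma fcalcD m M T f g S A : fcalc m M T f S -> fcalc m M T g A ->
  fcalc m M T (fun t => f t + g t) (S + A).
Proof.
move=> fS gA e e0; have e2 : 0 < e / 2 by rewrite divr_gt0.
have [p [pf pS]] := fS _ e2; have [q [qg qA]] := gA _ e2.
exists (p + q); split=> [t tmM|]; rewrite (splitr e).
  rewrite hornerD opprD addrACA (le_trans (ler_normD _ _))//.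
  by rewrite lerD ?pf ?qg.
by rewrite poly_opD opprD addrACA; exact: op_boundD.
Qed.

Lemma fcalcZ m M T a g S : fcalc m M T g S ->
  fcalc m M T (fun t => a * g t) (a%:C *: S).
Proof.
move=> gS e e0; have a1 : 0 < `|a| + 1 by rewrite ltr_wpDl.
have [p [pg pS]] := gS _ (divr_gt0 e0 a1).
have ae : `|a| * (e / (`|a| + 1)) <= e.
  by rewrite mulrCA ler_piMr ?(ltW e0)// ler_pdivrMr// mul1r lerDl.
exists (a *: p); split=> [t tmM|].
  rewrite hornerZ -mulrBr normrM (le_trans _ ae)// ler_wpM2l//.
  exact: pg.
by rewrite poly_opZ -scalerBr; apply: op_bound_le ae _; exact: op_boundZ.
Qed.

Lemma positive_op_limit S :
  (forall e, 0 < e -> exists A, positive_op A /\ op_bound e (A - S)) ->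
  positive_op S.
Proof.
move=> SA.
have small (z : R[i]) c : 0 <= c -> (forall e, 0 < e -> `|z| <= (e * c)%:C) -> z = 0.
  move=> c0 zc; apply/normr0_eq0/eqP; rewrite eq_le normr_ge0 andbT.
  have <- : (complex.Re `|z|)%:C = `|z| by rewrite RRe_real.
  rewrite lecR; apply/ler_addgt0Pr => d d0; rewrite add0r -lecR RRe_real//.
  have c1 : 0 < c + 1 by rewrite ltr_wpDl.
  apply: le_trans (zc _ (divr_gt0 d0 c1)) _; rewrite lecR.
  by rewrite mulrAC ler_pdivrMr// ler_wpM2l ?lerDl// ltW.
have bnd D e x y : op_bound e D ->
    `|inner (D x) y| <= (e * (complex.Re `|x| * complex.Re `|y|))%:C.
  move=> De; rewrite !rmorphM/= !Re_norm (le_trans (inner_CS _ _))// mulrA.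
  by rewrite ler_wpM2r.
have sS : selfadjoint S.
  move=> x y; apply/eqP; rewrite -subr_eq0; apply/eqP.
  apply: (small _ (2 * (complex.Re `|x| * complex.Re `|y|))).
    by rewrite !mulr_ge0// -ler0c Re_norm.
  move=> e e0; have [A [[sA _] AS]] := SA e e0.
  have -> : inner (S x) y - inner x (S y) =
      inner x ((A - S) y) - inner ((A - S) x) y.
    by rewrite !bopE innerDl innerDr innerNl innerNr sA; ring.
  rewrite (le_trans (ler_normB _ _))//.
  have -> : e * (2 * (complex.Re `|x| * complex.Re `|y|)) =
    e * (complex.Re `|x| * complex.Re `|y|) + e * (complex.Re `|x| * complex.Re `|y|) by ring.
  rewrite rmorphD lerD//; last exact: bnd.
  rewrite innerC norm_conjC [X in e * X]mulrC. exact: bnd.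
split=> // x; rewrite -selfadjoint_real// ler0c.
have nx : 0 <= complex.Re `|x| by rewrite -ler0c Re_norm.
apply/ler_addgt0Pr => d d0.
have c1 : 0 < complex.Re `|x| * complex.Re `|x| + 1 by rewrite ltr_wpDl// mulr_ge0.
have [A [pA AS]] := SA _ (divr_gt0 d0 c1).
have := bnd _ _ x x AS => /(le_trans (normc_ge_Re _)).
rewrite lecR bopE innerDl innerNl raddfB/= => AxSx.
have Ax : 0 <= complex.Re (inner (A x) x).
  by rewrite -ler0c selfadjoint_real ?pA.2//; exact: pA.1.
have : complex.Re (inner (A x) x) - complex.Re (inner (S x) x) <= d.
  apply: le_trans (ler_norm _) _; apply: le_trans AxSx _.
  by rewrite mulrAC ler_pdivrMr// ler_wpM2l ?lerDl// ltW.
lra.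
Qed.

(** An approximant p of g >= 0 is only >= - e / 2 on [m, M], so e / 2 is added. *)
Lemma fcalc_positive m M T g S : sa_spec `[m, M] T -> fcalc m M T g S ->
  (forall t, t \in `[m, M] -> 0 <= g t) -> positive_op S.
Proof.
move=> TmM gS g0; apply: positive_op_limit => e e0.
have e2 : 0 < e / 2 by rewrite divr_gt0.
have [p [pg pS]] := gS _ e2.
exists (poly_op (p + (e / 2)%:P) T); split.
  apply: poly_op_positive => [||t /(sa_spec_in TmM) tmM].
  - exact: TmM.1.
  - exact: sa_spec_real TmM.
  have := g0 t tmM; have := pg t tmM; rewrite !hornerE ler_norml => /andP[]; lra.
rewrite poly_opD poly_opC addrAC [X in op_bound X](splitr e); apply: op_boundD => // x.
by rewrite scalar_opE normrZ ger0_norm ?ler0c ?(ltW e2).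
Qed.

(** If q approximates the square root on the range of (t - c)^2, then
q((t - c)^2) approximates |t - c|. *)
Lemma fcalc_abs m M T c : sa_spec `[m, M] T ->
  fcalc m M T (fun t => `|t - c|) (abs_op (T - scalar_op c%:C)).
Proof.
move=> TmM.
pose r : {poly R} := ('X - c%:P) * ('X - c%:P).
have rE t : r.[t] = (t - c) ^+ 2 by rewrite /r !hornerE expr2.
have rT : poly_op r T = (T - scalar_op c%:C) ^+ 2.
  by rewrite poly_opM poly_op_XsubC expr2.
pose K := (`|m - c| + `|M - c|) ^+ 2 + 1.
have K0 : 0 < K by rewrite ltr_wpDl// sqr_ge0.
have rK t : t \in `[m, M] -> r.[t] \in `[0, K].
  rewrite !in_itv/= => /andP[mt tM]; rewrite rE sqr_ge0/= /K.
  apply: ler_wpDr => //; rewrite -[leLHS]real_normK ?num_real//.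
  rewrite ler_sqr ?nnegrE ?addr_ge0// ler_norml.
  have := ler_norm (M - c); have := ler_norm (- (m - c)); rewrite normrN.
  have := normr_ge0 (M - c); have := normr_ge0 (m - c).
  by move=> *; apply/andP; split; lra.
have rTK : sa_spec `[0, K] (poly_op r T).
  split=> [|z /poly_op_spectrum[]]; first exact/selfadjoint_poly/TmM.1.
  - exact: TmM.1.
  - exact: sa_spec_real TmM.
  by move=> t /(sa_spec_in TmM) tmM ->; exists r.[t] => //; exact: rK.
have sc : {within `[0, K], continuous (@Num.sqrt R)}.
  by apply: continuous_subspaceT => t; exact: sqrt_continuous.
move=> e e0; have [q [qs qT]] := fcalc_cfc K0 rTK sc e0.
exists (q \Po r); split=> [t tmM|]; last by rewrite poly_op_comp /abs_op -rT.
by rewrite horner_comp -(sqrtr_sqr (t - c)) -rE; apply/qs/rK.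
Qed.

End ContinuousCalculus.

(** * The operator inequality *)

(** Identities between linear combinations of operators, tested on inner
products. *)
Ltac bop_ring :=
  apply: bop_innerP => ? ?;
  rewrite !(bopE, innerDl, innerNl, innerZl); field; try done.

Section OperatorInequality.
Context {R : realType} {H : hilbertType R}.
Implicit Types (A S T : {bop H}) (f : R -> R) (m M : R).

Lemma cfc_le_tent m M f T : m < M -> sa_spec `[m, M] T ->
  {within `[m, M], continuous f} ->
  convex_function (`[m, M]%classic : set R^o) f ->
  let delta := f m + f M - 2 * f ((m + M) / 2) in
  le_op (cfc f T)
    (scalar_op ((M * f m - m * f M) / (M - m) - delta / 2)%:C
     + ((f M - f m) / (M - m))%:C *: T
     + (delta / (M - m))%:C *: abs_op (T - scalar_op ((m + M) / 2)%:C)).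
Proof.
move=> mM TmM fc fcvx delta.
set a := (M * f m - m * f M) / (M - m) - delta / 2.
set b := (f M - f m) / (M - m).
set mid := (m + M) / 2.
have lin : fcalc m M T (fun t => (a%:P + b *: 'X).[t]) (scalar_op a%:C + b%:C *: T).
  have -> : scalar_op a%:C + b%:C *: T = poly_op (a%:P + b *: 'X) T.
    rewrite poly_opD poly_opC poly_opZ; congr (_ + _ *: _).
    by rewrite -['X]subr0 -[0]/(0%:P) poly_op_XsubC /scalar_op scale0r subr0.
  exact: fcalc_poly.
have ff := fcalcZ (-1) (fcalc_cfc mM TmM fc).
have fa := fcalcZ (delta / (M - m)) (fcalc_abs mid TmM).
have := fcalcD (fcalcD lin fa) ff; rewrite rmorphN1 scaleN1r.
move=> /(fcalc_positive TmM); apply => t tmM.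
have := convex_tent mM fcvx tmM; rewrite -/mid -/delta !hornerE.
have Mm0 : M - m != 0 by rewrite subr_eq0 gt_eqF.
rewrite -subr_ge0 => /le_trans; apply; rewrite le_eqVlt; apply/orP; left; apply/eqP.
by rewrite /a /b; field.
Qed.

Lemma sa_spec_ge m M T : sa_spec `[m, M] T -> le_op (scalar_op m%:C) T.
Proof.
move=> TmM; rewrite /le_op -poly_op_XsubC; apply: poly_op_positive.
- exact: TmM.1.
- exact: sa_spec_real TmM.
- move=> t /(sa_spec_in TmM); rewrite /= in_itv/= !hornerE subr_ge0.
  by case/andP.
Qed.

Lemma sa_spec_le m M T : sa_spec `[m, M] T -> le_op T (scalar_op M%:C).
Proof.
move=> TmM; rewrite /le_op -opprB -poly_op_XsubC -poly_opN; apply: poly_op_positive.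
- exact: TmM.1.
- exact: sa_spec_real TmM.
- move=> t /(sa_spec_in TmM); rewrite /= in_itv/= !hornerE opprB subr_ge0.
  by case/andP.
Qed.

Lemma abs_op_le m M T : sa_spec `[m, M] T ->
  le_op (abs_op (T - scalar_op ((m + M) / 2)%:C)) (scalar_op ((M - m) / 2)%:C).
Proof.
move=> TmM; rewrite /le_op.
have := fcalcD (fcalc_poly m M T ((M - m) / 2)%:P)
  (fcalcZ (-1) (fcalc_abs ((m + M) / 2) TmM)).
rewrite rmorphN1 scaleN1r poly_opC => /(fcalc_positive TmM); apply => t.
rewrite in_itv/= hornerE mulN1r subr_ge0 => /andP[mt tM].
by rewrite ler_norml; apply/andP; split; lra.
Qed.

Lemma abs_opN T : abs_op (- T) = abs_op T.
Proof. by rewrite /abs_op sqrrN. Qed.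

End OperatorInequality.

Section UnitalFamily.
Context {R : realType} {H : hilbertType R} {n : nat}.
Implicit Types (Phi : 'I_n -> {linear {bop H} -> {bop H}}) (m M : R).

Lemma unital_scalar Phi z : \sum_(i < n) Phi i 1 = 1 ->
  \sum_(i < n) Phi i (scalar_op z) = scalar_op z.
Proof.
move=> Phi1; rewrite /scalar_op -[X in _ = _ *: X]Phi1 scaler_sumr.
by apply: eq_bigr => i _; rewrite linearZ.
Qed.

Lemma sum_positive_map_le Phi (S T : 'I_n -> {bop H}) :
  (forall i, positive_map (Phi i)) -> (forall i, le_op (S i) (T i)) ->
  le_op (\sum_(i < n) Phi i (S i)) (\sum_(i < n) Phi i (T i)).
Proof.
move=> Phi_pos ST; rewrite /le_op -sumrB; elim/big_ind: _.
- exact: positive_op0.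
- exact: positive_opD.
- by move=> i _; rewrite -linearB; apply: Phi_pos; exact: ST.
Qed.

Lemma unital_spec Phi m M (B : 'I_n -> {bop H}) :
  (forall i, positive_map (Phi i)) -> \sum_(i < n) Phi i 1 = 1 ->
  (forall i, sa_spec `[m, M] (B i)) ->
  sa_spec `[m, M] (\sum_(i < n) Phi i (B i)).
Proof.
move=> Phi_pos Phi1 BmM; apply: spectrum_segment; rewrite -(unital_scalar _ Phi1).
  by apply: sum_positive_map_le => // i; exact: sa_spec_ge (BmM i).
by apply: sum_positive_map_le => // i; exact: sa_spec_le (BmM i).
Qed.

End UnitalFamily.

Theorem corollary3p1 (R : realType) (H : hilbertType R) (n : nat)
    (Phi : 'I_n -> {linear {bop H} -> {bop H}}) (B : 'I_n -> {bop H})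
    (m M : R) (f : R -> R)
    (Phi_pos : forall i, positive_map (Phi i))
    (Phi_unital : \sum_(i < n) Phi i 1 = 1)
    (mM : m < M)
    (B_spec : forall i, sa_spec `[m, M] (B i))
    (f_cont : {within `[m, M], continuous f})
    (f_convex : convex_function (`[m, M]%classic : set R^o) f) :
  let mid := (m + M) / 2 in
  let PhiB := \sum_(i < n) Phi i (B i) in
  let PhifB := \sum_(i < n) Phi i (cfc f (B i)) in
  let delta_f := f m + f M - 2 * f mid in
  let Btilde : {bop H} :=
    1 - ((M - m)^-1)%:C *:
      (\sum_(i < n) Phi i (abs_op (B i - scalar_op mid%:C))
       + abs_op (PhiB - scalar_op mid%:C)) in
  le_op (cfc f (scalar_op (m + M)%:C - PhiB))
        (scalar_op (f m + f M)%:C - PhifB - delta_f%:C *: Btilde)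
  /\
  le_op (scalar_op (f m + f M)%:C - PhifB - delta_f%:C *: Btilde)
        (scalar_op (f m + f M)%:C - PhifB).
Proof.
move=> mid PhiB PhifB delta Bt.
have spB : sa_spec `[m, M] PhiB by exact: unital_spec.
pose C := scalar_op (m + M)%:C - PhiB.
have spC : sa_spec `[m, M] C.
  apply: spectrum_segment.
    have -> : C - scalar_op m%:C = scalar_op M%:C - PhiB by bop_ring.
    exact: sa_spec_le spB.
  have -> : scalar_op M%:C - C = PhiB - scalar_op m%:C by bop_ring.
  exact: sa_spec_ge spB.
have absC : abs_op (C - scalar_op mid%:C) = abs_op (PhiB - scalar_op mid%:C).
  rewrite -[in RHS]abs_opN; congr abs_op.
  have -> : C = scalar_op (2 * mid)%:C - PhiB.
    by rewrite /C /mid; congr (scalar_op _%:C - _); field.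
  by bop_ring.
pose k := (M - m)^-1.
pose X := \sum_(i < n) Phi i (abs_op (B i - scalar_op mid%:C)).
pose Y := abs_op (PhiB - scalar_op mid%:C).
have Mm0 : 0 < M - m by rewrite subr_gt0.
have k0 : 0 < k by rewrite invr_gt0.
have kMm : k * (M - m) = 1 by rewrite mulVf// gt_eqF.
have BtE : Bt = 1 - k%:C *: (X + Y) by [].
have delta0 : 0 <= delta by exact: convex_midpoint.
(* chord t - delta / 2 = a + b t *)
set a := (M * f m - m * f M) / (M - m) - delta / 2.
set b := (f M - f m) / (M - m).
have abE : f m + f M = 2 * a + b * (m + M) + delta.
  by rewrite /a /b; field; rewrite gt_eqF.
have HB : le_op PhifB (scalar_op a%:C + b%:C *: PhiB + (delta * k)%:C *: X).
  have -> : scalar_op a%:C + b%:C *: PhiB + (delta * k)%:C *: X =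
      \sum_(i < n) Phi i (scalar_op a%:C + b%:C *: B i
        + (delta * k)%:C *: abs_op (B i - scalar_op mid%:C)).
    rewrite -[in LHS](unital_scalar _ Phi_unital) 2!scaler_sumr -2!big_split/=.
    by apply: eq_bigr => i _; rewrite 2!linearD; congr (_ + _ + _);
      exact/esym/linearZ_LR.
  by apply: (sum_positive_map_le Phi_pos) => i; exact: cfc_le_tent.
have HC : le_op (cfc f C) (scalar_op a%:C + b%:C *: C + (delta * k)%:C *: Y).
  have := cfc_le_tent mM spC f_cont f_convex.
  by rewrite /= -/delta -/mid -/a -/b absC.
have HX : le_op X (scalar_op ((M - m) / 2)%:C).
  rewrite -(unital_scalar _ Phi_unital).
  by apply: (sum_positive_map_le Phi_pos) => i; exact: abs_op_le.
have HY : le_op Y (scalar_op ((M - m) / 2)%:C) by exact: abs_op_le.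
split; rewrite BtE /le_op -/C.
  have := positive_opD HB HC; congr positive_op.
  rewrite abE /C; clearbody a b delta k X Y PhiB PhifB.
  by bop_ring.
have := positive_opZ (mulr_ge0 delta0 (ltW k0)) (positive_opD HX HY).
have -> : delta%:C *: (1 - k%:C *: (X + Y)) =
    delta%:C *: (scalar_op (k * (M - m))%:C - k%:C *: (X + Y)).
  by rewrite kMm /scalar_op scale1r.
congr positive_op; clearbody delta k X Y PhiB PhifB; by bop_ring.
Qed.
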